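(* Fix a dimension $d\ge 1$. There is a constant $C_d>0$ such that for any set $S$ of $n\ge 2$ points in $\mathbb{R}^d$ there exists a radii assignment $r:S\to\mathbb{R}^+$ such that $r(s)\le R_{\min}$ for all $s\in S$, the directed graph $G'_r$ (asymmetric model) is strongly connected, and the interference of $r$ is at most $C_d\log\Delta$.
   Context: $d(\cdot,\cdot)$ is the Euclidean distance on $\mathbb{R}^d$. A radii assignment is a function $r:S\to\mathbb{R}^+$ (positive reals). In the asymmetric model it defines a directed graph $G'_r=(S,E')$ with a directed edge from $u$ to $v$ ($u\ne v$) if and only if $r(u)\ge d(u,v)$. The interference of $p\in\mathbb{R}^d$ is $I(p)=|\{s\in S: r(s)\ge d(s,p)\}|$, and the interference of $r$ is $\max_{p\in\mathbb{R}^d} I(p)$. $R_{\min}$ is the minimum $R$ such that, under the uniform assignment $r\equiv R$, the resulting graph on $S$ (points at distance at most $R$ being adjacent) is connected; equivalently, the length of the longest edge of a Euclidean minimum spanning tree of $S$. $\Delta$ is the interference of the uniform assignment $r\equiv R_{\min}$ (so $\Delta\ge 2$). *)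

(* Defs.v *)
From mathcomp Require Import all_boot all_order all_algebra.
From mathcomp Require Import finmap.
From mathcomp Require Import boolp classical_sets reals exp.

Set Implicit Arguments.
Unset Strict Implicit.
Unset Printing Implicit Defensive.

Import Order.TTheory GRing.Theory Num.Theory.
Local Open Scope ring_scope.

(* The library norm on ['rV[R]_d] is the sup norm, not the Euclidean one. *)
Definition edist (R : realType) (d : nat) (x y : 'rV[R]_d) : R :=
  Num.sqrt (\sum_(i < d) (x 0 i - y 0 i) ^+ 2).

Section Interference.
Variables (R : realType) (d : nat) (S : {fset 'rV[R]_d}).

Definition radii_assignment (r : S -> R) : Prop := forall s, 0 < r s.

Definition asym_edge (r : S -> R) : rel S :=
  fun u v => (u != v) && (edist (val u) (val v) <= r u).

Definition uniform_edge (rho : R) : rel S :=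
  fun u v => (u != v) && (edist (val u) (val v) <= rho).

(* For a directed [e] this is strong connectivity, for a symmetric [e]        *)
(* ordinary connectivity.                                                     *)
Definition strongly_connected (e : rel S) : Prop := forall u v, connect e u v.

Definition interference_at (r : S -> R) (p : 'rV[R]_d) : nat :=
  #|[set s : S | edist (val s) p <= r s]|.

(* The maximum over all points of the space is taken over the finitely many   *)
(* values that [interference_at r] can have; see [interferenceP].             *)
Definition interference (r : S -> R) : nat :=
  \max_(k < #|{: S}|.+1 | `[< exists p, interference_at r p = k >]) k.

(* This infimum is a minimum as soon as [S] has two points; see [RminP].      *)
Definition Rmin : R :=
  inf [set rho : R | 0 < rho /\ strongly_connected (uniform_edge rho)]%classic.

Definition Delta : nat := interference (fun=> Rmin).

Lemma interferenceP (r : S -> R) :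
  (exists p, interference_at r p = interference r) /\
  (forall p, interference_at r p <= interference r)%N.
Proof.
have lt_at p : (interference_at r p < #|{: S}|.+1)%N by rewrite ltnS max_card.
have ub p : (interference_at r p <= interference r)%N.
  apply: (bigop.bigmax_sup (Ordinal (lt_at p))) => //=.
  by apply/asboolP; exists p.
split=> //; pose k0 := Ordinal (lt_at 0).
rewrite /interference (@bigop.bigmax_eq_arg _ k0); last first.
  by apply/asboolP; exists 0.
by case: arg_maxnP => [|k /asboolP[p pk] _]; [apply/asboolP; exists 0 | exists p].
Qed.

Lemma edist_ge0 (x y : 'rV[R]_d) : 0 <= edist x y.
Proof. exact: sqrtr_ge0. Qed.

Lemma edist_gt0 (x y : 'rV[R]_d) : x != y -> 0 < edist x y.
Proof.
move=> neq_xy; rewrite sqrtr_gt0 lt0r sumr_ge0 ?andbT; last first.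
  by move=> i _; apply: sqr_ge0.
apply: contra neq_xy => /eqP sum0; apply/eqP/rowP => i; apply/eqP.
rewrite -subr_eq0 -sqrf_eq0; apply/eqP.
by apply: (psumr_eq0P _ sum0) => // j _; apply: sqr_ge0.
Qed.

Lemma RminP : (1 < #|` S|)%N ->
  [/\ 0 < Rmin, strongly_connected (uniform_edge Rmin)
    & forall rho, 0 < rho -> strongly_connected (uniform_edge rho) ->
        Rmin <= rho].
Proof.
move=> S_gt1; rewrite /Rmin; set A := [set rho | _]%classic.
pose D (p : S * S) : R := edist (val p.1) (val p.2).
have infA : has_inf A.
  split; last by exists 0 => rho [/ltW].
  exists (1 + \sum_p D p); split.
    by rewrite ltr_pwDl // sumr_ge0 // => p _; apply: edist_ge0.
  move=> u v; have [-> //|neq_uv] := eqVneq u v.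
  apply: connect1; rewrite /uniform_edge neq_uv (bigD1 (u, v)) //=.
  rewrite [D _ + _]addrC addrA lerDr addr_ge0 // sumr_ge0 // => p _.
  exact: edist_ge0.
pose eps := \big[Order.min/1]_(p | inf A < D p) (D p - inf A).
have eps_gt0 : 0 < eps by apply: lt_bigmin => // p; rewrite subr_gt0.
have [rho [_ rho_conn] lt_rho] := inf_adherent eps_gt0 infA.
have conn : strongly_connected (uniform_edge (inf A)).
  move=> u v; apply: connect_sub (rho_conn u v) => {u v} u v /andP[neq_uv le_uv].
  apply: connect1; rewrite /uniform_edge neq_uv /= leNgt; apply/negP => lt_uv.
  move: lt_rho; rewrite ltNge => /negP; apply.
  apply: le_trans le_uv; rewrite addrC -lerBrDr.
  exact: (bigmin_le_cond _ (j := (u, v))).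
split=> // [|tau tau_gt0 tau_conn]; last by apply: ge_inf; [case: infA|].
have : (1 < #|{: S}|)%N by rewrite -cardfE.
case/card_gt1P => u [v [_ _ neq_uv]].
have /connectP[[|w p] /=] := conn u v.
  by move=> _ eq_vu; rewrite eq_vu eqxx in neq_uv.
case/andP=> /andP[neq_uw le_uw] _ _; apply: lt_le_trans le_uw.
by apply: edist_gt0; rewrite (inj_eq val_inj).
Qed.

End Interference.

(* Main.v *)
(* Cut space into cubes of side Rmin / d, so that a cube has diameter less than
   Rmin and contains at most Delta points, and a ball of radius Rmin meets only
   boundedly many cubes. Inside a cube, let every point reach its nearest
   neighbour, keep at most half of the points so that every point leads to a kept
   one, and repeat: after log Delta rounds a single root is left. In each round
   boundedly many disks contain a given point p: two such centres are at least as
   far from each other as either is from p, hence are seen from p at an angle of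
   at least 60 degrees. Finally the root of each cube, and one point of the cube for
   each neighbouring cube that can be reached from it, get the radius Rmin: the
   root then reaches its whole cube, and every edge of the uniform graph is
   simulated by a path. *)
Require Import Defs.
From mathcomp Require Import all_boot all_order all_algebra.
From mathcomp Require Import finmap.
From mathcomp Require Import boolp classical_sets reals exp.
From mathcomp Require Import lra.
From mathcomp Require Import fintype finset.
Import Order.TTheory GRing.Theory Num.Theory.
Local Open Scope ring_scope.

(** * Halving a finite set along a map without fixed points *)

Lemma fconnect_halving (T : finType) (f : T -> T) (A : {set T}) :
    (forall a, a \in A -> f a \in A /\ f a != a) ->
  exists B : {set T}, [/\ B \subset A, (#|B|.*2 <= #|A|)%N
    & forall a, a \in A -> exists2 b, b \in B & fconnect f a b].
Proof.
move=> fA.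
pose Q (B : {set T}) :=
  (B \subset A) && [forall a in A, exists b in B, fconnect f a b].
(* For a smallest [B] that absorbs every orbit, [f] maps [B] injectively into
   the complement of [B]: otherwise [b] could be dropped from [B], or two
   elements with the same image be replaced by that image. *)
have QA : Q A.
  rewrite /Q subxx; apply/forall_inP => a aA; apply/exists_inP.
  by exists a.
case: (@arg_minnP _ A Q (fun B => #|B|) QA) => B /andP[BA /forall_inP reachB] minB.
have reach a : a \in A -> exists2 b, b \in B & fconnect f a b.
  by move=> /reachB /exists_inP.
exists B; split=> //.
have fB b : b \in B -> f b \notin B.
  move=> bB; apply/negP => fbB.
  have [_ fb_neq] := fA b (subsetP BA b bB).
  suff /minB : Q (B :\ b) by rewrite (cardsD1 b B) bB ltnn.
  rewrite /Q (subset_trans (subsetDl _ _) BA); apply/forall_inP => a aA.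
  apply/exists_inP; have [c cB ac] := reach a aA.
  have [eq_cb|neq_cb] := eqVneq c b; last by exists c => //; rewrite !inE neq_cb.
  exists (f b); first by rewrite !inE fb_neq.
  by apply: connect_trans ac _; rewrite eq_cb fconnect1.
have f_inj : {in B &, injective f}.
  move=> b c bB cB eq_f; apply/eqP/negPn/negP => neq_bc.
  suff /minB : Q (f b |: (B :\ b :\ c)).
    rewrite cardsU1 (cardsD1 b B) (cardsD1 c (B :\ b)) bB !inE eq_sym neq_bc cB.
    by rewrite leqNgt ltnS leq_add2r leq_b1.
  have [fbA _] := fA b (subsetP BA b bB).
  rewrite /Q subUset sub1set fbA; apply/andP; split.
    by rewrite (subset_trans (subsetDl _ _)) // (subset_trans (subsetDl _ _)).
  apply/forall_inP => a aA.
  apply/exists_inP; have [e eB ae] := reach a aA.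
  have [eq_eb|neq_eb] := eqVneq e b.
    exists (f b); first by rewrite !inE eqxx.
    by apply: connect_trans ae _; rewrite eq_eb fconnect1.
  have [eq_ec|neq_ec] := eqVneq e c.
    exists (f b); first by rewrite !inE eqxx.
    by apply: connect_trans ae _; rewrite eq_ec eq_f fconnect1.
  by exists e => //; rewrite !inE neq_eb neq_ec eB orbT.
rewrite -addnn -{1}(card_in_imset f_inj) -cardsUI.
have -> : (f @: B) :&: B = set0.
  apply/eqP; rewrite setI_eq0 disjoints_subset; apply/subsetP => _ /imsetP[b bB ->].
  by rewrite inE fB.
rewrite cards0 addn0 subset_leq_card // subUset BA andbT.
by apply/subsetP => _ /imsetP[b bB ->]; have [] := fA b (subsetP BA b bB).
Qed.

(** * Cubic grid: cube diameter and neighbouring cubes *)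

Section Grid.
Variables (R : realType) (d : nat).
Hypothesis d_gt0 : (0 < d)%N.
Implicit Types (x y : 'rV[R]_d) (rho : R) (k : 'rV[int]_d).

Let d_gt0R : 0 < d%:R :> R.
Proof. by rewrite ltr0n. Qed.

Definition cell rho x : 'rV[int]_d := \row_i Num.floor (d%:R * x 0 i / rho).

(* An entry [j] of an offset stands for the displacement [j - (d + 1)]. *)
Definition offset := {ffun 'I_d -> 'I_(d.+1.*2.+1)}.

Definition shift k (delta : offset) : 'rV[int]_d :=
  \row_i (k 0 i + (delta i : nat)%:Z - d.+1%:Z).

(** Cubes are half-open of side [rho / d], so each coordinate differs by strictly less than
    [rho / d], and the [d] squares add up to less than [rho ^+ 2 / d]. *)
Lemma same_cell_lt rho x y :
  0 < rho -> cell rho x = cell rho y -> edist x y < rho.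
Proof.
move=> rho_gt0 eq_cell.
have lt_coord i : (x 0 i - y 0 i) ^+ 2 < (rho / d%:R) ^+ 2.
  have := congr1 (fun k : 'rV[int]_d => k 0 i) eq_cell; rewrite !mxE => eq_floor.
  have := floor_le (d%:R * x 0 i / rho); have := floorD1_gt (d%:R * x 0 i / rho).
  have := floor_le (d%:R * y 0 i / rho); have := floorD1_gt (d%:R * y 0 i / rho).
  rewrite -eq_floor intrD; set z := (Num.floor _)%:~R => y2 y1 x2 x1.
  have : `|d%:R * x 0 i / rho - d%:R * y 0 i / rho| < 1.
    by rewrite ltr_norml; lra.
  rewrite -mulrBl -mulrBr normrM normrM normfV (gtr0_norm d_gt0R) (gtr0_norm rho_gt0).
  rewrite ltr_pdivrMr // mul1r mulrC -ltr_pdivlMr // => lt_abs.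
  rewrite -real_normK ?num_real // ltr_pXn2r // ?nnegrE ?normr_ge0 //.
  by rewrite divr_ge0 // ltW.
rewrite -[ltRHS]gtr0_norm // -sqrtr_sqr ltr_sqrt ?exprn_gt0 //.
apply: (@lt_le_trans _ _ (\sum_(i < d) (rho / d%:R) ^+ 2)).
  by apply: ltr_sum => //; apply/hasP; exists (Ordinal d_gt0); rewrite ?mem_index_enum.
rewrite sumr_const card_ord expr_div_n -[leLHS]mulr_natl mulrCA -[leRHS]mulr1.
rewrite ler_pM2l ?exprn_gt0 // [X in X^-1]expr2 invfM mulrA divff ?gt_eqF // mul1r.
by rewrite invf_le1 // ler1n.
Qed.

(** After scaling by [d / rho], coordinates differ by at most [d], so their floors differ by at most
    [d + 1], the range that an offset covers. *)
Lemma near_cell rho x y :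
  0 < rho -> edist x y <= rho -> exists delta, cell rho y = shift (cell rho x) delta.
Proof.
move=> rho_gt0 le_xy.
have coord i : `|Num.floor (d%:R * y 0 i / rho) - Num.floor (d%:R * x 0 i / rho)| <= d.+1%:Z.
  have : `|x 0 i - y 0 i| <= rho.
    apply: le_trans le_xy; rewrite -sqrtr_sqr ler_sqrt; last first.
      by apply: sumr_ge0 => j _; apply: sqr_ge0.
    rewrite (bigD1 i) //= lerDl; apply: sumr_ge0 => j _; exact: sqr_ge0.
  move=> le_abs.
  have : `|d%:R * x 0 i / rho - d%:R * y 0 i / rho| <= d%:R.
    rewrite -mulrBl -mulrBr normrM normrM normfV (gtr0_norm d_gt0R) (gtr0_norm rho_gt0).
    by rewrite ler_pdivrMr // ler_pM2l.
  have := floor_le (d%:R * x 0 i / rho); have := floorD1_gt (d%:R * x 0 i / rho).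
  have := floor_le (d%:R * y 0 i / rho); have := floorD1_gt (d%:R * y 0 i / rho).
  move: (Num.floor _) (Num.floor _) => m n.
  rewrite !intrD ler_norml => y2 y1 x2 x1 /andP[h1 h2].
  rewrite -(ler_int R) intr_norm intrB ler_norml.
  by rewrite -[(d.+1)%:~R]/(d.+1%:R : R) -natr1; lra.
pose w (i : 'I_d) : int :=
  Num.floor (d%:R * y 0 i / rho) - Num.floor (d%:R * x 0 i / rho) + d.+1%:Z.
have wE i : `|w i|%N%:Z = w i.
  have := coord i; rewrite ler_norml => /andP[+ _].
  by rewrite -subr_ge0 opprK => /gez0_abs.
exists [ffun i => inord `|w i|%N]; apply/rowP => i; rewrite !mxE ffunE inordK.
  by rewrite wE addrA addrK addrC subrK.
rewrite ltnS -lez_nat wE -addnn PoszD lerD2r.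
by have := coord i; rewrite ler_norml => /andP[].
Qed.

(** * Euclidean angles and the packing bound *)

Lemma edistE x y : edist x y ^+ 2 = \sum_(i < d) (x 0 i - y 0 i) ^+ 2.
Proof. by rewrite sqr_sqrtr //; apply: sumr_ge0 => i _; apply: sqr_ge0. Qed.

Lemma edistC x y : edist x y = edist y x.
Proof.
by rewrite /edist; congr Num.sqrt; apply: eq_bigr => i _; rewrite -sqrrN opprB.
Qed.

Lemma edistxx x : edist x x = 0.
Proof. by rewrite /edist big1 ?sqrtr0 // => i _; rewrite subrr expr0n. Qed.

(* Unit vectors within distance 1 make an angle below 60 degrees, so the side
   opposite to [p] cannot be the longest one of the triangle. *)
Lemma close_directions p x y : x != p -> y != p ->
    edist ((edist x p)^-1 *: (x - p)) ((edist y p)^-1 *: (y - p)) < 1 ->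
  edist x p <= edist y p -> edist x y < edist y p.
Proof.
move=> /edist_gt0 + /edist_gt0.
move: (edistE x p) (edistE y p); set a := edist x p; set b := edist y p.
move=> aE bE a_gt0 b_gt0 lt1 le_ab.
pose dot := \sum_(i < d) (x 0 i - p 0 i) * (y 0 i - p 0 i).
have lt2 : a ^+ 2 * (a^-1 ^+ 2) + b ^+ 2 * (b^-1 ^+ 2) - 2 * (a^-1 * b^-1) * dot < 1.
  apply: (@le_lt_trans _ _ (edist (a^-1 *: (x - p)) (b^-1 *: (y - p)) ^+ 2)).
    rewrite edistE aE bE /dot mulr_suml mulr_suml mulr_sumr -big_split /= -sumrB.
    by apply: ler_sum => i _; rewrite !mxE; lra.
  by rewrite expr_lt1 // edist_ge0.
have xyE : edist x y ^+ 2 = a ^+ 2 + b ^+ 2 - 2 * dot.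
  rewrite edistE aE bE /dot mulr_sumr -big_split /= -sumrB.
  by apply: eq_bigr => i _; lra.
(* The cosine of the angle at [p] exceeds 1/2; with the law of cosines [xyE] and [a <= b] this gives
   the claim. *)
have lt_dot : a * b < 2 * dot.
  move: lt2; rewrite -!exprMn !divff ?gt_eqF // expr1n => lt2.
  have : 1 < 2 * (a^-1 * b^-1) * dot by lra.
  rewrite -invfM mulrAC ltr_pdivlMr ?mulr_gt0 //; lra.
rewrite -(@ltr_pXn2r _ 2) ?nnegrE ?edist_ge0 ?(ltW b_gt0) // xyE.
have : a ^+ 2 <= a * b by rewrite expr2 ler_pM2l.
lra.
Qed.

(** Points of [A] are sorted by the unit-scale cube containing their direction from [p]. Two in the
    same cube would have directions at distance below 1, against [close_directions]. The extra 1
    allows for a point at [p] itself. *)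
Lemma packing (T : finType) (pos : T -> 'rV[R]_d) (p : 'rV[R]_d) (A : {set T}) :
    injective pos ->
    {in A &, forall s t, s != t -> edist (pos s) p <= edist (pos s) (pos t)} ->
  (#|A| <= #|{: offset}|.+1)%N.
Proof.
move=> pos_inj sepA.
pose A' := [set s in A | pos s != p].
pose dir s : 'rV[R]_d := (edist (pos s) p)^-1 *: (pos s - p).
(* Directions have length 1, so [near_cell] applies to them from the origin, here [p - p]. *)
have near s : s \in A' -> exists delta, cell 1 (dir s) == shift (cell 1 (p - p)) delta.
  rewrite inE => /andP[_ /edist_gt0 s_gt0].
  have [||delta ->] := @near_cell 1 (p - p) (dir s); last by exists delta.
    by [].
  rewrite -(@expr_le1 _ 2) ?edist_ge0 // edistC edistE.
  rewrite [leLHS](_ : _ = (edist (pos s) p)^-1 ^+ 2 * edist (pos s) p ^+ 2).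
    by rewrite -exprMn mulVf ?gt_eqF // expr1n.
  rewrite [in RHS]edistE mulr_sumr; apply: eq_bigr => i _; rewrite !mxE; lra.
(* The default value is never taken on [A'], by [near]. *)
pose off s : offset := odflt [ffun=> ord0]
  [pick delta | cell 1 (dir s) == shift (cell 1 (p - p)) delta].
have offE s : s \in A' -> cell 1 (dir s) = shift (cell 1 (p - p)) (off s).
  move=> /near[delta delta_s]; rewrite /off; case: pickP => [? /eqP //|/(_ delta)].
  by rewrite delta_s.
have off_inj : {in A' &, injective off}.
  move=> s t sA tA eq_off; apply/eqP/negPn/negP => neq_st.
  have close : edist (dir s) (dir t) < 1.
    apply: same_cell_lt ltr01 _; rewrite (offE s sA) (offE t tA).
    exact: congr1.
  move: sA tA; rewrite !inE => /andP[sA sp] /andP[tA tp].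
  (* The point farther from [p] would be closer to the other point than to [p], which [sepA]
     forbids. *)
  have [le_st|le_ts] := leP (edist (pos s) p) (edist (pos t) p).
    have := close_directions _ _ _ sp tp close le_st.
    by rewrite ltNge (edistC (pos s)) sepA // eq_sym.
  move: close; rewrite edistC => close.
  have := close_directions _ _ _ tp sp close (ltW le_ts).
  by rewrite ltNge (edistC (pos t)) sepA.
have card_A' : (#|A'| <= #|{: offset}|)%N.
  by rewrite -(card_in_imset off_inj) max_card.
have card_p : (#|[set s in A | pos s == p]| <= 1)%N.
  apply/card_le1_eqP => s t; rewrite !inE => /andP[_ /eqP sp] /andP[_ /eqP tp].
  by apply: pos_inj; rewrite sp tp.
rewrite -addn1; apply: leq_trans (leq_add card_A' card_p).
apply: leq_trans (leq_card_setU _ _); apply/subset_leq_card/subsetP => s sA.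
by rewrite !inE sA /= orNb.
Qed.
End Grid.

(** * Radii inside one cube: a tree directed to a root *)

Section SinkTree.
Variables (R : realType) (d : nat) (T : finType) (pos : T -> 'rV[R]_d).
Hypotheses (d_gt0 : (0 < d)%N) (pos_inj : injective pos).

Lemma nearest_neighbour (A : {set T}) : (1 < #|A|)%N ->
  exists f : T -> T, forall s, s \in A -> [/\ f s \in A, f s != s
    & forall t, t \in A -> t != s ->
        edist (pos s) (pos (f s)) <= edist (pos s) (pos t)].
Proof.
move=> A_gt1.
suff /boolp.choice[f fP] : forall s, exists t, s \in A -> [/\ t \in A, t != s
    & forall u, u \in A -> u != s ->
        edist (pos s) (pos t) <= edist (pos s) (pos u)] by exists f.
move=> s; have [sA|] := boolP (s \in A); last by exists s.
have /card_gt0P[t0] : (0 < #|A :\ s|)%N.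
  by move: A_gt1; rewrite (cardsD1 s A) sA.
rewrite !inE => t0P; pose P := [pred t | (t != s) && (t \in A)].
case: (@arg_minP _ _ _ t0 P (fun t => edist (pos s) (pos t)) t0P) => t.
move=> /andP[neq_ts tA] min_t.
by exists t => _; split=> // u uA neq_us; apply: min_t; rewrite /P /= neq_us.
Qed.

(** Induction on the size of [A]: the half [B] kept by [fconnect_halving] has a tree already, and
    the dropped points reach their nearest neighbours. The radius of the root stays free, to be
    raised later. That all others are distances within [A] makes them positive and at most the
    diameter of the cube. *)
Lemma sink_tree (A : {set T}) : A != set0 ->
  exists a (r : T -> R), [/\ a \in A,
    forall s, s \in A -> s != a ->
      exists2 t, t \in A & t != s /\ r s = edist (pos s) (pos t),
    forall s, s \in A -> connect [rel u v | [&& u \in A, v \in A, u != a, u != v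
      & edist (pos u) (pos v) <= r u]] s a
  & forall p, (#|[set s in A | (s != a) && (edist (pos s) p <= r s)%R]|
      <= #|{: offset d}|.+1 * trunc_log 2 #|A|)%N].
Proof.
have [n] := ubnP #|A|; elim: n A => // n IHn A; rewrite ltnS => le_An A_neq0.
have [A_le1|A_gt1] := leqP #|A| 1.
  have /set0Pn[a aA] := A_neq0; exists a, (fun=> 0).
  have eq_a s : s \in A -> s = a by move=> sA; apply: (card_le1_eqP A_le1).
  split=> // [s /eq_a ->|s /eq_a ->|p]; [by rewrite eqxx | exact: connect0 |].
  rewrite (_ : [set s in A | _] = set0) ?cards0 //; apply/setP => s; rewrite !inE.
  by have [/eq_a ->|] := boolP (s \in A); rewrite ?eqxx.
have [f fP] := nearest_neighbour _ A_gt1.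
have [|B [BA half_B reachB]] := @fconnect_halving _ f A.
  by move=> s /fP[].
have B_neq0 : B != set0.
  by have /set0Pn[s /reachB[b bB _]] := A_neq0; apply/set0Pn; exists b.
have le_half : (#|B| <= #|A|./2)%N by rewrite -(doubleK #|B|) half_leq.
have lt_Bn : (#|B| < n)%N.
  apply: leq_trans le_An; apply: leq_ltn_trans le_half _.
  by rewrite ltn_half_double -addnn -addn1 leq_add2l ltnW.
have [a [r [aB rB connB countB]]] := IHn B lt_Bn B_neq0.
have [subBA aA] := (subsetP BA, subsetP BA a aB).
pose r' s := if s \in B then r s else edist (pos s) (pos (f s)).
pose e := [rel u v | [&& u \in A, v \in A, u != a, u != v
  & edist (pos u) (pos v) <= r' u]].
have connB' s : s \in B -> connect e s a.
  move=> /connB; apply: connect_sub => u v /and5P[uB vB ua uv le_r].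
  by apply: connect1; rewrite /= /r' uB !subBA // ua uv.
exists a, r'; split=> //.
- move=> s sA neq_sa; rewrite /r'; case: ifP => [sB|_].
    by have [t tB tP] := rB s sB neq_sa; exists t => //; apply: subBA.
  by have [fsA neq_fs _] := fP s sA; exists (f s).
- move=> s sA; have [b bB /connectP[q]] := reachB s sA.
  (* The [f]-orbit is followed only until it first meets [B]; up to there each point is dropped and
     so has the radius to reach its image. *)
  elim: q s sA => [|t q IHq] s sA /=; first by move=> _ <-; apply: connB'.
  case/andP=> /eqP fs_t q_path q_last.
  have [sB|sB] := boolP (s \in B); first exact: connB'.
  have [fsA neq_fs _] := fP s sA; rewrite fs_t in fsA neq_fs.
  apply: connect_trans (IHq t fsA q_path q_last); apply: connect1.
  rewrite /= sA fsA (eq_sym s t) neq_fs /r' (negPf sB) fs_t lexx !andbT /=.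
  by apply: contraNneq sB => ->.
(* Halving [#|A|] lowers the logarithm by exactly one; this unit pays for the points dropped in this
   round, counted within [near]. *)
move=> p; rewrite trunc_log2S // mulnS.
pose near := [set s in A | edist (pos s) p <= edist (pos s) (pos (f s))].
have card_near : (#|near| <= #|{: offset d}|.+1)%N.
  apply: (packing _ _ d_gt0 _ pos p) => // s t; rewrite !inE.
  move=> /andP[sA le_s] /andP[tA _] neq_st; apply: le_trans le_s _.
  by have [_ _ ->] := fP s sA; rewrite // eq_sym.
have count_half := leq_trans (countB p)
  (leq_mul (leqnn _) (leq_trunc_log 2 le_half)).
apply: leq_trans (leq_add card_near count_half).
apply: leq_trans (leq_card_setU _ _); apply/subset_leq_card/subsetP => s.
rewrite !inE /r' => /and3P[-> ->]; case: ifP => //= _ ->; rewrite ?orbT //.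
Qed.
End SinkTree.

(** * Union bound and comparison of logarithms *)

Lemma card_bigcup_le (I T : finType) (F : I -> {set T}) (m : nat) :
  (forall i, (#|F i| <= m)%N) -> (#|\bigcup_i F i| <= #|I| * m)%N.
Proof.
move=> leF; rewrite -sum_nat_const.
apply: (@leq_trans (\sum_i #|F i|)); last by apply: leq_sum.
elim/big_rec2: _ => [|i n B _ le_Bn]; first by rewrite cards0.
by apply: leq_trans (leq_card_setU _ _) _; rewrite leq_add2l.
Qed.

Lemma trunc_log2_le_ln (R : realType) (n : nat) : (0 < n)%N ->
  (trunc_log 2 n)%:R * ln 2 <= ln n%:R :> R.
Proof.
move=> n_gt0; rewrite mulr_natl -lnXn ?ltr0n // -natrX.
rewrite ler_ln ?posrE ?ltr0n ?expn_gt0 // ler_nat.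
exact: trunc_logP.
Qed.

(** * Joining the trees of all cubes *)

Section MainBound.
Variables (R : realType) (d : nat) (S : {fset 'rV[R]_d}).
Hypotheses (d_gt0 : (0 < d)%N) (S_gt1 : (2 <= #|` S|)%N).

Let rho := Rmin S.
Let N := #|{: offset d}|.
Let c (s : S) := cell _ _ rho (val s).
Let A k := [set s : S | c s == k].

Let rho_gt0 : 0 < rho.
Proof. by have [] := RminP S_gt1. Qed.

(** Both ends of an edge of the uniform graph cover one of these ends. This makes
    [trunc_log 2 (Delta S)] positive, so that it absorbs additive constants. *)
Lemma Delta_ge2 : (2 <= Delta S)%N.
Proof.
have [_ conn _] := RminP S_gt1.
have : (1 < #|{: S}|)%N by rewrite -cardfE.
case/card_gt1P => u [v [_ _ neq_uv]].
have /connectP[[|w q] /=] := conn u v.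
  by move=> _ eq_vu; rewrite eq_vu eqxx in neq_uv.
case/andP=> /andP[neq_uw le_uw] _ _.
have [_ /(_ (val u))] := interferenceP (fun _ : S => rho).
apply: leq_trans; apply: (@leq_trans #|[set u; w]|).
  by rewrite cards2 neq_uw.
apply/subset_leq_card/subsetP => s; rewrite !inE => /orP[] /eqP ->.
  by rewrite edistxx ltW.
by rewrite edistC.
Qed.

(** Under the uniform radius, every point of a cube covers any chosen point of that cube. *)
Lemma card_cell_le_Delta k : (#|A k| <= Delta S)%N.
Proof.
have [->|/set0Pn[s]] := eqVneq (A k) set0; first by rewrite cards0.
rewrite inE => /eqP sk.
have [_ /(_ (val s))] := interferenceP (fun _ : S => rho).
apply: leq_trans; apply/subset_leq_card/subsetP => t; rewrite !inE => /eqP tk.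
by apply/ltW/same_cell_lt => //; rewrite -[LHS]/(c t) tk -sk.
Qed.

(** A point is covered only from [N] cubes, each contributing its root, at most [N] gates and the
    tree points counted by [sink_tree]. *)
Lemma bounded_interference_radii : exists r : S -> R,
  [/\ radii_assignment r, forall s, r s <= rho, strongly_connected (asym_edge r)
    & (interference r <= N * (1 + N + N.+1 * trunc_log 2 (Delta S)))%N].
Proof.
have [_ conn _] := RminP S_gt1.
have /card_gt0P[s0 _] : (0 < #|{: S}|)%N by rewrite -cardfE ltnW.
(* One tree is chosen per cube; empty cubes get a dummy root [s0]. *)
have /boolp.choice[ar arP] : forall k, exists ar : S * (S -> R), A k != set0 ->
    [/\ ar.1 \in A k,
      forall s, s \in A k -> s != ar.1 ->
        exists2 t, t \in A k & t != s /\ ar.2 s = edist (val s) (val t),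
      forall s, s \in A k -> connect [rel u v | [&& u \in A k, v \in A k,
          u != ar.1, u != v & edist (val u) (val v) <= ar.2 u]] s ar.1
    & forall p, (#|[set s in A k | (s != ar.1) && (edist (val s) p <= ar.2 s)%R]|
      <= N.+1 * trunc_log 2 #|A k|)%N].
  move=> k; have [Ak0|/(sink_tree _ _ _ _ d_gt0 val_inj)[a [r ar]]] := eqVneq (A k) set0.
    by exists (s0, fun=> 0) => /eqP[].
  by exists (a, r).
pose root k := (ar k).1; pose rad k := (ar k).2.
pose gate k (delta : offset d) := [pick u : S | (c u == k) &&
  [exists v : S, (c v == shift _ k delta) && uniform_edge rho u v]].
pose hub s := (s == root (c s)) || [exists delta, gate (c s) delta == Some s].
pose r s := if hub s then rho else rad (c s) s.
have inA s : s \in A (c s) by rewrite inE.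
have A_neq0 s : A (c s) != set0 by apply/set0Pn; exists s.
have r_tree s : s != root (c s) ->
    0 < rad (c s) s <= rho.
  move=> neq_s; have [_ radE _ _] := arP (c s) (A_neq0 s).
  have [t] := radE s (inA s) neq_s; rewrite inE => /eqP eq_c [neq_ts].
  rewrite /rad => ->; rewrite edist_gt0 ?(inj_eq val_inj) 1?eq_sym //=.
  by apply/ltW/same_cell_lt => //; symmetry.
have r_bounds s : 0 < r s <= rho.
  rewrite /r; case: ifP => [_|]; first by rewrite rho_gt0 lexx.
  by rewrite /hub => /norP[/r_tree].
have le_rad s : s != root (c s) -> rad (c s) s <= r s.
  by rewrite /r; case: ifP => // _ /r_tree /andP[].
(* Raising hubs to [rho] keeps all tree edges, since tree radii are at most [rho]. *)
have to_root s : connect (asym_edge r) s (root (c s)).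
  have [_ _ conn_s _] := arP (c s) (A_neq0 s).
  apply: connect_sub (conn_s s (inA s)) => u v /and5P[].
  rewrite !inE => /eqP uk _ ua uv le_uv.
  apply: connect1; rewrite /asym_edge uv /=.
  by apply: le_trans le_uv _; rewrite -uk in ua *; apply: le_rad.
have root_c s : c (root (c s)) = c s.
  by have [] := arP (c s) (A_neq0 s); rewrite inE => /eqP.
have from_root s : connect (asym_edge r) (root (c s)) s.
  have [->|neq_s] := eqVneq s (root (c s)); first by rewrite root_c.
  apply: connect1; rewrite /asym_edge eq_sym neq_s /r /hub root_c eqxx /=.
  by apply/ltW/same_cell_lt; rewrite // -[LHS]/(c _) root_c.
have in_cell s t : c s = c t -> connect (asym_edge r) s t.
  by move=> eq_c; apply: connect_trans (to_root s) _; rewrite eq_c.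
exists r; split=> //.
- by move=> s; have /andP[] := r_bounds s.
- by move=> s; have /andP[] := r_bounds s.
(* An edge from [u] to [v] becomes a path from [u] to the gate [u'] in its cube, across to some [v']
   in the cube of [v], and on to [v]. *)
- move=> s t; apply: connect_sub (conn s t) => u v uv.
  have [delta delta_uv] : exists delta, c v = shift _ (c u) delta.
    by apply: near_cell => //; have /andP[] := uv.
  case gateE: (gate (c u) delta) => [u'|]; last first.
    (* The gate exists, as [u] itself qualifies with witness [v]. *)
    move: gateE; rewrite /gate; case: pickP => // /(_ u); rewrite eqxx /=.
    by move=> /existsP[]; exists v; rewrite delta_uv eqxx uv.
  have hub_u' : c u' = c u -> hub u'.
    by move=> cu'; apply/orP; right; apply/existsP; exists delta; rewrite cu' gateE.
  move: gateE; rewrite /gate; case: pickP => // x /andP[/eqP cu' /existsP[v']].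
  move=> /andP[/eqP cv' /andP[uv' le_uv']] [eq_u'].
  rewrite eq_u' in cu' uv' le_uv'.
  apply: connect_trans (in_cell u u' _) _ => //.
  apply: connect_trans (in_cell v' v _); last by rewrite cv' delta_uv.
  by apply: connect1; rewrite /asym_edge uv' /r hub_u'.
have [[p <-] _] := interferenceP r.
pose k delta := shift _ (cell _ _ rho p) delta.
pose F delta := [set s in A (k delta) | edist (val s) p <= r s].
apply: leq_trans (subset_leq_card (B := \bigcup_delta F delta) _) _.
  apply/subsetP => s; rewrite inE => le_sp.
  have [|delta c_s] := @near_cell _ _ d_gt0 rho p (val s) rho_gt0.
    by rewrite edistC; apply: le_trans le_sp _; have /andP[] := r_bounds s.
  by apply/bigcupP; exists delta => //; rewrite !inE le_sp andbT /k -c_s.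
apply: card_bigcup_le => delta; rewrite /F {F}; move: (k delta) => {}k.
have [Ak0|Ak_neq0] := eqVneq (A k) set0.
  by rewrite (_ : [set s in _ | _] = set0) ?cards0 //; apply/setP => s; rewrite Ak0 !inE.
have [_ _ _ countk] := arP k Ak_neq0.
pose G := \bigcup_delta' [set s : S | gate k delta' == Some s].
have card_G : (#|G| <= N)%N.
  rewrite -[leqRHS]muln1; apply: card_bigcup_le => delta'.
  by apply/card_le1_eqP => s t; rewrite !inE => /eqP -> /eqP[].
pose near := [set s in A k | (s != root k) && (edist (val s) p <= rad k s)].
have card_near : (#|near| <= N.+1 * trunc_log 2 (Delta S))%N.
  apply: leq_trans (countk p) _; rewrite leq_mul2l leq_trunc_log ?orbT //.
  exact: card_cell_le_Delta.
apply: leq_trans (leq_add (leq_add (eq_leq (cards1 (root k))) card_G) card_near).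
apply: leq_trans (leq_add (leq_card_setU _ _) (leqnn _)).
apply: leq_trans (leq_card_setU _ _); apply/subset_leq_card/subsetP => s.
rewrite !inE => /andP[/eqP cs]; rewrite /r /hub cs.
case: eqP => //= neq_s; case: existsP => [[delta' gate_s] _|_ ->].
  by rewrite (_ : s \in G) //; apply/bigcupP; exists delta'; rewrite ?inE.
by rewrite eqxx orbT.
Qed.
End MainBound.

Theorem corollary1 (R : realType) (d : nat) (d_gt0 : (0 < d)%N) :
  exists C : R, 0 < C /\
    forall S : {fset 'rV[R]_d}, (2 <= #|` S|)%N ->
      exists r : S -> R,
        [/\ radii_assignment r,
            forall s : S, r s <= Rmin S,
            strongly_connected (asym_edge r)
          & (interference r)%:R <= C * ln ((Delta S)%:R : R)].
Proof.
(* Since [t >= 1], the sum [1 + N + N.+1 * t] is at most [(1 + N + N.+1) * t]; dividing by [ln 2]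
   passes to the natural logarithm. *)
pose N := #|{: offset d}|; pose M := (N * (1 + N + N.+1))%N.
have ln2_gt0 : 0 < ln 2 :> R by rewrite ln_gt0 // ltr1n.
have M_gt0 : (0 < M)%N.
  by rewrite muln_gt0 addn_gt0 orbT andbT; apply/card_gt0P; exists [ffun=> ord0].
exists (M%:R / ln 2); split; first by rewrite divr_gt0 ?ltr0n.
move=> S S_gt1; have [r [r_gt0 r_le r_conn le_M]] := bounded_interference_radii _ _ S d_gt0 S_gt1.
exists r; split=> //; set t := trunc_log 2 (Delta S) in le_M.
have Delta2 := Delta_ge2 _ _ S S_gt1.
have t_gt0 : (0 < t)%N by rewrite trunc_log_gt0.
apply: (@le_trans _ _ (M%:R * t%:R)).
  rewrite -natrM ler_nat; apply: leq_trans le_M _.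
  by rewrite -mulnA leq_mul2l mulnDl leq_add2r leq_pmulr ?orbT.
rewrite -mulrA ler_pM2l ?ltr0n // mulrC ler_pdivlMr //.
by apply: trunc_log2_le_ln; apply: ltnW.
Qed.
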